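(* Let $\mathcal{A}\in\mathbb{R}^{m\times l\times n}$, $\mathcal{B}\in\mathbb{R}^{m\times p\times n}$, and let $I_\le,I_=$ be disjoint sets partitioning $\{1,\dots,m\}$. Suppose that the system $$\mathcal{A}_{i::}*\mathcal{X}\le\mathcal{B}_{i::}\ (i\in I_\le),\qquad \mathcal{A}_{i::}*\mathcal{X}=\mathcal{B}_{i::}\ (i\in I_=)$$ in the unknown $\mathcal{X}\in\mathbb{R}^{l\times p\times n}$ has a nonempty feasible region $\Omega$. Then there exists a constant $\gamma>0$ such that for any $\mathcal{X}\in\mathbb{R}^{l\times p\times n}$, $$d(\mathcal{X},\Omega)\le\gamma\,\|c_T(\mathcal{A}*\mathcal{X}-\mathcal{B})\|_F.$$
   Context: For $\mathcal{A}\in\mathbb{R}^{m\times l\times n}$, $A_k=\mathcal{A}(:,:,k)$ is the $k$-th frontal slice and $\mathcal{A}_{i::}=\mathcal{A}(i,:,:)\in\mathbb{R}^{1\times l\times n}$ the $i$-th row slice. $\mathrm{unfold}(\mathcal{A})\in\mathbb{R}^{mn\times l}$ stacks $A_1,\dots,A_n$ vertically, and $\mathrm{fold}$ is its inverse. $\mathrm{bcirc}(\mathcal{A})\in\mathbb{R}^{mn\times ln}$ is the block circulant matrix whose $(r,s)$ block is $A_{((r-s)\bmod n)+1}$ (first block column $A_1,\dots,A_n$). The t-product of $\mathcal{A}\in\mathbb{R}^{m\times l\times n}$ and $\mathcal{X}\in\mathbb{R}^{l\times p\times n}$ is $\mathcal{A}*\mathcal{X}=\mathrm{fold}(\mathrm{bcirc}(\mathcal{A})\,\mathrm{unfold}(\mathcal{X}))\in\mathbb{R}^{m\times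 p\times n}$. $\|\mathcal{A}\|_F=\big(\sum_{i,j,k}\mathcal{A}(i,j,k)^2\big)^{1/2}$, and $d(\mathcal{X},\Omega)=\min_{\mathcal{Y}\in\Omega}\|\mathcal{X}-\mathcal{Y}\|_F$. Inequalities between tensors are entrywise. The function $c_T:\mathbb{R}^{m\times p\times n}\to\mathbb{R}^{m\times p\times n}$ is $c_T(\mathcal{Z})(i,j,k)=\max\{\mathcal{Z}(i,j,k),0\}$ if $i\in I_\le$ and $c_T(\mathcal{Z})(i,j,k)=\mathcal{Z}(i,j,k)$ if $i\in I_=$. *)

(* Defs.v *)
From HB Require Import structures.
From mathcomp Require Import all_boot all_order all_algebra.
From mathcomp Require Import classical_sets reals.

Set Implicit Arguments.
Unset Strict Implicit.
Unset Printing Implicit Defensive.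

Import Order.TTheory GRing.Theory Num.Theory.

Local Open Scope classical_set_scope.
Local Open Scope ring_scope.

(* A tensor is the family of its frontal slices: A(i, j, k) is [A k i j], and
   the zmodType structure of finite functions is the entrywise one. *)
Notation tensor R m l n := {ffun 'I_n -> 'M[R]_(m, l)}.

Section Tensor.
Variable R : realType.

Definition row_slice m l n (A : tensor R m l n) (i : 'I_m) : tensor R 1 l n :=
  [ffun k => row i (A k)].

(* The type of block matrices is 'M_(\sum_(k < n) m, l), where
   \sum_(k < n) m is equal, but not convertible, to m * n. *)
Definition unfold m l n (A : tensor R m l n) : 'M[R]_(\sum_(k < n) m, l) :=
  \mxcol_(k < n) A k.

Definition fold m l n (M : 'M[R]_(\sum_(k < n) m, l)) : tensor R m l n :=
  [ffun k => submxcol M k].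

Lemma ord_subm_proof n (r s : 'I_n) : ((r + (n - s)) %% n < n)%N.
Proof. exact: ltn_pmod (leq_ltn_trans (leq0n r) (ltn_ord r)). Qed.

(* (r - s) mod n; n is added first because subtraction on nat is truncated. *)
Definition ord_subm n (r s : 'I_n) : 'I_n := Ordinal (ord_subm_proof r s).

Definition bcirc m l n (A : tensor R m l n) :
    'M[R]_(\sum_(r < n) m, \sum_(s < n) l) :=
  \mxblock_(r < n, s < n) A (ord_subm r s).

Definition tprod m l p n (A : tensor R m l n) (X : tensor R l p n) :
    tensor R m p n :=
  fold (bcirc A *m unfold X).

Definition frob_norm m l n (A : tensor R m l n) : R :=
  Num.sqrt (\sum_(i < m) \sum_(j < l) \sum_(k < n) A k i j ^+ 2).

Definition tensor_le m l n (A B : tensor R m l n) : Prop :=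
  forall (i : 'I_m) (j : 'I_l) (k : 'I_n), A k i j <= B k i j.

(* [is_dist X Omega d] says that d is the minimum, attained, of the Frobenius
   distances from X to the points of Omega. *)
Definition is_dist m l n (X : tensor R m l n) (Omega : set (tensor R m l n))
    (d : R) : Prop :=
  let D := [set frob_norm (X - Y) | Y in Omega] in D d /\ lbound D d.

Definition feasible m l p n (A : tensor R m l n) (B : tensor R m p n)
    (Ile Ieq : {set 'I_m}) : set (tensor R l p n) :=
  [set X | (forall i, i \in Ile ->
              tensor_le (tprod (row_slice A i) X) (row_slice B i)) /\
           (forall i, i \in Ieq ->
              tprod (row_slice A i) X = row_slice B i)].

(* For complementary index sets, the indices outside Ile are those of the
   equality constraints. *)
Definition cT m p n (Ile : {set 'I_m}) (Z : tensor R m p n) : tensor R m p n :=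
  [ffun k => \matrix_(i, j)
     if i \in Ile then Num.max (Z k i j) 0 else Z k i j].

End Tensor.

(* Main.v *)
Require Import Defs.
From HB Require Import structures.
From mathcomp Require Import all_boot all_order all_algebra.
From mathcomp Require Import classical_sets reals.
From mathcomp Require Import boolp sesquilinear ring lra.

Set Implicit Arguments.
Unset Strict Implicit.
Unset Printing Implicit Defensive.

Import Order.TTheory GRing.Theory Num.Theory.

Local Open Scope ring_scope.

(** Entrywise, the system is a finite list of affine equalities and
    inequalities, each saying something of the inner product of X with a fixed
    tensor. The theorem is thus Hoffman's error bound for a polyhedron P given
    by equalities E and inequalities L, and that bound holds in any inner
    product space, together with the existence of a nearest point of P.

    Both are proved by induction on the number of inequalities ([hoffman]). To
    project x on P cut by a half-space a.x <= b, first project it on P alone,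
    at a point y. If a.y <= b, then y is also the projection on the smaller
    polyhedron. Otherwise, every u in the smaller polyhedron can be joined to y
    by a segment that crosses the hyperplane a.x = b inside P, and as y is
    nearest to x, the crossing point is at least as near to x as u is
    ([polyhedron_crossing]). So the projection on P cut by the hyperplane is the
    one sought, and that polyhedron has one inequality less.

    The constant survives the second case, in which the violation of a.x = b
    must be bounded: above the hyperplane it is the violation of a.x <= b;
    below it, x and y are on opposite sides, so it is at most a.(y - x), hence
    at most |a| |x - y|, which the bound for P already controls. No choice in
    this argument lets the constant depend on x: each step only uses the
    constants of P and of P cut by the hyperplane.

    Without inequalities the statement is orthogonal projection on an affine
    subspace, obtained by adding one equation at a time as in the Gram-Schmidt
    process ([kernel_projection], [affine_projection]). *)

(** * Inner product spaces *)

Section InnerProductSpace.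
Variables (R : rcfType) (V : lmodType R) (dot : {dot V for idfun}).
Implicit Types (a u v w x y : V) (E L : seq (V * R)).

Definition norm u : R := Num.sqrt (dot u u).

Lemma dotC u v : dot u v = dot v u.
Proof. by rewrite (hermC dot) expr0 mul1r. Qed.

Lemma dot0l v : dot 0 v = 0. Proof. exact: linear0l. Qed.
Lemma dotDl u v w : dot (u + v) w = dot u w + dot v w.
Proof. exact: linearDl. Qed.
Lemma dotNl u v : dot (- u) v = - dot u v. Proof. exact: linearNl. Qed.
Lemma dotZl k u v : dot (k *: u) v = k * dot u v.
Proof. exact: linearZl_LR. Qed.
Lemma dotBl u v w : dot (u - v) w = dot u w - dot v w.
Proof. exact: linearBl. Qed.
Lemma dot0r u : dot u 0 = 0. Proof. exact: linear0r. Qed.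
Lemma dotDr u v w : dot w (u + v) = dot w u + dot w v.
Proof. exact: linearDr. Qed.
Lemma dotZr k u v : dot v (k *: u) = k * dot v u.
Proof. exact: linearZr_LR. Qed.
Lemma dotBr u v w : dot w (u - v) = dot w u - dot w v.
Proof. exact: linearBr. Qed.

Lemma dot_gt0 u : u != 0 -> 0 < dot u u.
Proof. exact: neq0_dnorm_gt0. Qed.

Lemma dot_ge0 u : 0 <= dot u u.
Proof.
have [->|u0] := eqVneq u 0; first by rewrite dot0l.
exact: ltW (dot_gt0 u0).
Qed.

Lemma norm_ge0 u : 0 <= norm u.
Proof. exact: sqrtr_ge0. Qed.

Lemma sqr_norm u : norm u ^+ 2 = dot u u.
Proof. exact: sqr_sqrtr (dot_ge0 u). Qed.

Lemma norm_le u v : (norm u <= norm v) = (dot u u <= dot v v).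
Proof. by rewrite ler_sqrt ?dot_ge0. Qed.

Lemma normZ c u : norm (c *: u) = `|c| * norm u.
Proof.
rewrite /norm dotZl dotZr /= mulrA -expr2 sqrtrM ?sqr_ge0 //.
by rewrite sqrtr_sqr.
Qed.

Lemma normr_dot_le u v : `|dot u v| <= norm u * norm v.
Proof.
have [->|v0] := eqVneq v 0.
  by rewrite dot0r normr0 mulr_ge0 ?norm_ge0.
have vv := dot_gt0 v0.
rewrite /norm -sqrtrM ?dot_ge0 // -sqrtr_sqr ler_sqrt ?mulr_ge0 ?dot_ge0 //.
have := dot_ge0 (dot v v *: u - dot u v *: v).
rewrite dotBl !dotBr !dotZl !dotZr /= (dotC v u) => H.
have {H} : 0 <= dot v v * (dot u u * dot v v - dot u v ^+ 2) by lra.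
by rewrite pmulr_rge0 // subr_ge0.
Qed.

Lemma norm_triangle u v : norm (u + v) <= norm u + norm v.
Proof.
rewrite -(ler_pXn2r (n := 2)) ?nnegrE ?addr_ge0 ?norm_ge0 //.
rewrite sqrrD !sqr_norm dotDl !dotDr (dotC v u).
have := le_trans (ler_norm _) (normr_dot_le u v); lra.
Qed.

(** * Orthogonal projection on the kernel of finitely many functionals *)

(** Gram-Schmidt: the projection a' of a on the orthogonal of F is again given
    by the induction hypothesis, and subtracting a multiple of a' corrects the
    new equation without disturbing those of F. *)
Lemma kernel_projection (F : seq V) :
  exists2 g : R, 0 <= g & forall x, exists y,
    [/\ forall a, a \in F -> dot a y = 0,
        forall v, (forall a, a \in F -> dot a v = 0) -> dot (x - y) v = 0 &
        norm (x - y) <= g * \sum_(a <- F) `|dot a x|].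
Proof.
elim: F => [|a F [g g0 IH]].
  exists 0 => // x; exists x.
  by split=> // [v _|]; rewrite subrr ?dot0l // mul0r /norm dot0l sqrtr0.
have [a' [Fa' aa' _]] := IH a.
(* When a' = 0, the vector a is orthogonal to the kernel of F, which is then
   also the kernel of a :: F. *)
have [a'0|a'N0] := eqVneq a' 0.
  exists g => // x; have [y [Fy xy le]] := IH x; exists y; split.
  - move=> c; rewrite inE => /orP[/eqP->|]; last exact: Fy.
    by rewrite -(aa' _ Fy) a'0 subr0.
  - by move=> v Fv; apply: xy => c cF; apply: Fv; rewrite inE cF orbT.
  - rewrite big_cons mulrDr (le_trans le) // lerDr.
    by rewrite mulr_ge0.
have a'a' : 0 < dot a' a' := dot_gt0 a'N0.
have na' : 0 < norm a' by rewrite sqrtr_gt0.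
have daa' : dot a a' = dot a' a'.
  by apply/eqP; rewrite -subr_eq0 -dotBl aa'.
have da'v v : (forall b, b \in F -> dot b v = 0) -> dot a' v = dot a v.
  by move=> Fv; apply/esym/eqP; rewrite -subr_eq0 -dotBl aa'.
(* Correcting y moves it by |a.y| / |a'|, and |a.y| is at most |a.x| + |a| |x - y|,
   of which the bound on |x - y| makes a multiple of the residual. *)
exists (g + (1 + norm a * g) / norm a').
  by rewrite addr_ge0 // divr_ge0 ?addr_ge0 ?mulr_ge0 ?norm_ge0.
move=> x; have [y [Fy xy le]] := IH x.
set S := \sum_(b <- F) _ in le.
exists (y - (dot a y / dot a' a') *: a'); split.
- move=> b; rewrite dotBr dotZr /= inE => /orP[/eqP->|bF].
    by rewrite daa' divfK ?subrr // gt_eqF.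
  by rewrite (Fy b) ?(Fa' b) // mulr0 subrr.
- move=> v Fv.
  have Fv' b : b \in F -> dot b v = 0 by move=> bF; rewrite Fv // inE bF orbT.
  rewrite opprB addrA addrAC dotDl xy // dotZl /= (da'v v) //.
  by rewrite (Fv a) ?mem_head // mulr0 addr0.
- rewrite big_cons -/S opprB addrA addrAC.
  have S0 : 0 <= S by rewrite sumr_ge0.
  have day : `|dot a y| <= `|dot a x| + norm a * (g * S).
    have -> : dot a y = dot a x - dot a (x - y).
      by rewrite dotBr opprB addrC subrK.
    rewrite (le_trans (ler_normB _ _)) // lerD2l.
    by rewrite (le_trans (normr_dot_le _ _)) // ler_wpM2l ?norm_ge0.
  have -> : (g + (1 + norm a * g) / norm a') * (`|dot a x| + S) =
    g * S + (`|dot a x| + norm a * (g * S)) / norm a' +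
    (g * `|dot a x| + (norm a * g * `|dot a x| + S) / norm a').
    by field; rewrite gt_eqF.
  rewrite (le_trans (norm_triangle _ _)) // -[leLHS]addr0 lerD //.
    rewrite lerD // normZ normrM normfV (gtr0_norm a'a') -sqr_norm.
    have -> : `|dot a y| / norm a' ^+ 2 * norm a' = `|dot a y| / norm a'.
      by field; rewrite gt_eqF.
    by rewrite ler_wpM2r // invr_ge0 ltW.
  rewrite addr_ge0 ?divr_ge0 ?addr_ge0 ?mulr_ge0 ?norm_ge0 //.
Qed.

(** * Polyhedra and nearest points *)

Definition polyhedron E L x : Prop :=
  (forall c, c \in E -> dot c.1 x = c.2) /\
  (forall c, c \in L -> dot c.1 x <= c.2).

Definition violation E L x : R :=
  \sum_(c <- E) `|dot c.1 x - c.2| +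
  \sum_(c <- L) Num.max (dot c.1 x - c.2) 0.

Lemma violation_ge0 E L x : 0 <= violation E L x.
Proof.
by rewrite addr_ge0 ?sumr_ge0 // => c _; rewrite le_max lexx orbT.
Qed.

Lemma polyhedron_segment E L u y t : 0 <= t <= 1 ->
  polyhedron E L u -> polyhedron E L y -> polyhedron E L (u + t *: (y - u)).
Proof.
move=> /andP[t0 t1] [Eu Lu] [Ey Ly]; split=> c cin;
  rewrite dotDr dotZr dotBr /=.
  by rewrite Eu // Ey // subrr mulr0 addr0.
have := Lu _ cin; have := Ly _ cin; nra.
Qed.

(** The existence of a nearest point and the error bound go together, as the
    induction that proves the bound compares the nearest points of several
    polyhedra. *)
Definition nearest_point E L g x y : Prop :=
  [/\ polyhedron E L y,
      forall u, polyhedron E L u -> norm (x - y) <= norm (x - u) &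
      norm (x - y) <= g * violation E L x].

(** The affine subspace is a translate of the kernel, by any of its points. *)
Lemma affine_projection E : (exists x, polyhedron E [::] x) ->
  exists2 g : R, 0 <= g & forall x, exists y, nearest_point E [::] g x y.
Proof.
move=> [x0 Px0].
have [g g0 H] := kernel_projection [seq c.1 | c <- E].
exists g => // x; have [y [Ey xy le]] := H (x - x0).
have subE : x - (x0 + y) = x - x0 - y by rewrite opprD addrA.
exists (x0 + y); split.
- split=> // c cE; rewrite dotDr (Px0.1 _ cE) Ey ?addr0 //.
  exact: map_f.
- move=> u Pu; rewrite subE norm_le.
  (* By Pythagoras, as y - (u - x0) is in the kernel. *)
  have -> : x - u = (x - x0 - y) + (y - (u - x0)).
    by rewrite addrA subrK opprB addrA subrK.
  set p := x - x0 - y; set q := y - _.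
  have pq : dot p q = 0.
    apply: xy => c /mapP[d dE ->].
    rewrite dotBr Ey ?map_f // dotBr Pu.1 // Px0.1 //; lra.
  move: p q pq => p q pq; rewrite dotDl !dotDr (dotC q p) pq.
  have := dot_ge0 q; lra.
- rewrite subE (le_trans le) // /violation big_nil addr0 big_map.
  rewrite ler_wpM2l //; under eq_bigr do rewrite dotBr.
  rewrite le_eqVlt; apply/orP; left; apply/eqP.
  by apply: eq_big_seq => c cE; rewrite (Px0.1 _ cE).
Qed.

(** * Hoffman's error bound *)

(** The point v is where the segment from u to y meets the hyperplane; it is in
    the polyhedron by convexity, and convexity of the norm makes it no farther
    from x than the farther of u and y, which is u. *)
Lemma polyhedron_crossing E L a b x y u :
    polyhedron E L y -> polyhedron E L u -> dot a u <= b < dot a y ->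
    norm (x - y) <= norm (x - u) ->
  exists2 v, polyhedron ((a, b) :: E) L v & norm (x - v) <= norm (x - u).
Proof.
move=> Py Pu /andP[aub bay] xyu.
have day : 0 < dot a y - dot a u by rewrite subr_gt0 (le_lt_trans aub).
pose t := (b - dot a u) / (dot a y - dot a u).
have t01 : 0 <= t <= 1.
  by rewrite ler_pdivlMr // mul0r subr_ge0 aub ler_pdivrMr // mul1r lerD2r ltW.
have [Ev Lv] := polyhedron_segment t01 Pu Py.
exists (u + t *: (y - u)).
  split=> // c; rewrite inE => /orP[/eqP->|/Ev//] /=.
  rewrite dotDr dotZr dotBr /= divfK ?gt_eqF //.
  by rewrite addrC subrK.
have -> : x - (u + t *: (y - u)) = (1 - t) *: (x - u) + t *: (x - y).
  have -> : t *: (x - y) = t *: (x - u) - t *: (y - u).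
    by rewrite -scalerBr opprB addrA subrK.
  by rewrite scalerBl scale1r addrA subrK opprD addrA.
case/andP: t01 => t0 t1.
have := norm_triangle ((1 - t) *: (x - u)) (t *: (x - y)).
rewrite !normZ ger0_norm ?subr_ge0 // (ger0_norm t0); nra.
Qed.

(** The induction is on the inequalities, for all lists of equalities at once,
    since the second case turns an inequality into an equality. *)
Lemma hoffman E L : (exists x, polyhedron E L x) ->
  exists2 g : R, 0 <= g & forall x, exists y, nearest_point E L g x y.
Proof.
elim: L E => [|[a b] L IH] E; first exact: affine_projection.
move=> [x0 Px0].
have [|g g0 H] := IH E.
  exists x0; split=> [|c cL]; [exact: Px0.1 | by rewrite Px0.2 // inE cL orbT].
(* The polyhedron cut by the hyperplane may be empty; then the second case below
   never occurs, and any constant will do. *)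
have [g' g'0 H'] : exists2 g' : R, 0 <= g' &
    (exists z, polyhedron ((a, b) :: E) L z) ->
    forall x, exists z, nearest_point ((a, b) :: E) L g' x z.
  have [ne|emp] := EM (exists z, polyhedron ((a, b) :: E) L z).
    by have [g' g'0 H'] := IH _ ne; exists g'.
  by exists 0.
(* The first case needs g. In the second, the violation for P cut by the
   hyperplane is at most 1 + |a| g times the violation for P cut by the
   half-space. *)
exists (g + g' * (1 + norm a * g)).
  by rewrite addr_ge0 ?mulr_ge0 ?addr_ge0 ?mulr_ge0 ?norm_ge0.
move=> x; have [y [Py ymin ybd]] := H x.
have PE u : polyhedron E ((a, b) :: L) u <-> dot a u <= b /\ polyhedron E L u.
  split=> [[Eu Lu]|[au [Eu Lu]]].
    split; first exact: (Lu _ (mem_head _ _)).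
    by split=> // c cL; rewrite Lu // inE cL orbT.
  by split=> // c; rewrite inE => /orP[/eqP->|/Lu].
set vx := violation E ((a, b) :: L) x.
have vE : vx = violation E L x + Num.max (dot a x - b) 0.
  by rewrite /vx /violation big_cons addrCA addrC.
set r := violation E L x in ybd vE.
have r0 : 0 <= r := violation_ge0 _ _ _.
have [ayb|bay] := leP (dot a y) b.
  exists y; split; first exact/PE.
    by move=> u /PE[_ /ymin].
  rewrite (le_trans ybd) // -/vx vE ler_pM // lerDl ?le_max ?lexx ?orbT //.
  by rewrite mulr_ge0 ?addr_ge0 ?mulr_ge0 ?norm_ge0.
have cross u : polyhedron E ((a, b) :: L) u ->
    exists2 v, polyhedron ((a, b) :: E) L v & norm (x - v) <= norm (x - u).
  by move=> /PE[aub Pu]; apply: polyhedron_crossing Py Pu _ (ymin _ Pu);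
    rewrite aub.
have [|z [Pz zmin zbd]] := H' _ x.
  by have [v Pv _] := cross _ Px0; exists v.
exists z; split.
- by apply/PE; case: Pz => Ez Lz; split; [rewrite (Ez _ (mem_head _ _))|
    split=> // c cE; rewrite Ez // inE cE orbT].
- by move=> u /cross[v Pv]; apply: le_trans; apply: zmin.
have v'E : violation ((a, b) :: E) L x = `|dot a x - b| + r.
  by rewrite /violation big_cons -addrA.
(* Below the hyperplane, b - a.x < a.y - a.x = - a.(x - y). *)
have axb : `|dot a x - b| <= Num.max (dot a x - b) 0 + norm a * (g * r).
  have [bx|xb] := leP b (dot a x).
    rewrite ger0_norm ?subr_ge0 // -[leLHS]addr0 lerD ?le_max ?lexx //.
    by rewrite !mulr_ge0 ?norm_ge0.
  rewrite ltr0_norm ?subr_lt0 // opprB.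
  rewrite -[leLHS]add0r lerD ?le_max ?lexx ?orbT //.
  have /le_trans := le_trans (ler_norm _) (normr_dot_le (- a) (x - y)).
  rewrite dotNl dotBr.
  have -> : norm (- a) = norm a by rewrite -scaleN1r normZ normrN1 mul1r.
  move=> /(_ _ (ler_wpM2l (norm_ge0 a) ybd)); lra.
rewrite (le_trans zbd) // v'E -/vx vE.
set s := Num.max _ _ in axb *.
have s0 : 0 <= s by rewrite le_max lexx orbT.
rewrite (le_trans (ler_wpM2l g'0 (lerD axb (lexx r)))) // -subr_ge0.
have -> : (g + g' * (1 + norm a * g)) * (r + s) -
    g' * (s + norm a * (g * r) + r)
    = g * (r + s) + g' * (norm a * (g * s)) by ring.
by rewrite addr_ge0 // !mulr_ge0 ?norm_ge0 // addr_ge0.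
Qed.

End InnerProductSpace.

(** * The Frobenius inner product *)

Section TensorInnerProduct.
Variables (R : realType) (m l n : nat).
Implicit Types (U W X Z : tensor R m l n).

(** The order of summation is that of [frob_norm], which makes [frob_norm U] and
    [norm tdot U] convertible. *)
Definition tdot U W : R :=
  \sum_(i < m) \sum_(j < l) \sum_(k < n) U k i j * W k i j.

Lemma tdot_hermitian U W : tdot U W = (-1) ^+ false * idfun (tdot W U).
Proof. by rewrite mul1r; do 3 apply: eq_bigr => ? _; rewrite mulrC. Qed.

Lemma tdot_bilinear : bilinear_for *%R (idfun \; *%R) tdot.
Proof.
have tdotP W c U X : tdot (c *: U + X) W = c * tdot U W + tdot X W.
  do 3 (rewrite mulr_sumr -big_split /=; apply: eq_bigr => ? _).
  by rewrite !ffunE !mxE mulrDl mulrA.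
split=> W c U X /=; first exact: tdotP.
by rewrite ![tdot W _]tdot_hermitian /= !mul1r tdotP.
Qed.

Lemma sqr_entry_le_tdot U k i j : U k i j ^+ 2 <= tdot U U.
Proof.
rewrite /tdot (bigD1 i) //= (bigD1 j) //= (bigD1 k) //= -expr2 -!addrA lerDl.
by rewrite !addr_ge0 //; do ? [apply: sumr_ge0 => ? _]; rewrite -expr2 sqr_ge0.
Qed.

Lemma tdot_gt0 U : U != 0 -> 0 < tdot U U.
Proof.
rewrite ltNge; apply: contraNN => U2; apply/eqP/ffunP => k; apply/matrixP => i j.
apply/eqP; rewrite ffunE mxE -sqrf_eq0 eq_le sqr_ge0 andbT.
exact: le_trans (sqr_entry_le_tdot _ _ _ _) U2.
Qed.

HB.instance Definition _ := bilinear_isBilinear.Build R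
  (tensor R m l n) (tensor R m l n) R _ _ tdot tdot_bilinear.
HB.instance Definition _ := @isHermitianSesquilinear.Build R
  (tensor R m l n) false idfun tdot tdot_hermitian.
HB.instance Definition _ :=
  isDotProduct.Build R (tensor R m l n) tdot tdot_gt0.

Lemma entry_le_frob_norm U k i j : `|U k i j| <= frob_norm U.
Proof. by rewrite -sqrtr_sqr ler_wsqrtr // sqr_entry_le_tdot. Qed.

End TensorInnerProduct.
Arguments tdot {R m l n}.

(** * The system as a polyhedron *)

Section TensorSystem.
Variables (R : realType) (m l p n : nat).
Variables (A : tensor R m l n) (B : tensor R m p n).
Implicit Types (X : tensor R l p n) (e : 'I_n * 'I_m * 'I_p).

Lemma tprodE q (C : tensor R q l n) X k :
  tprod C X k = \sum_(s < n) C (ord_subm k s) *m X s.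
Proof. by rewrite ffunE mul_mxblock_mxrow mxcolK. Qed.

Lemma row_sliceE q h (C : tensor R q h n) i k i0 j :
  row_slice C i k i0 j = C k i j.
Proof. by rewrite ffunE mxE. Qed.

Lemma tprod_row_slice i X k i0 j :
  tprod (row_slice A i) X k i0 j = tprod A X k i j.
Proof.
rewrite !tprodE !summxE; apply: eq_bigr => s _.
by rewrite !mxE; apply: eq_bigr => t _; rewrite row_sliceE.
Qed.

(** The tensor whose inner product with X is the entry e = (k, i, j) of the
    t-product of A and X: only column j of X contributes. *)
Definition tprod_coef e : tensor R l p n :=
  [ffun s => \matrix_(t, j) (A (ord_subm e.1.1 s) e.1.2 t *+ (j == e.2))].

Definition entry (Z : tensor R m p n) e : R := Z e.1.1 e.1.2 e.2.

Lemma tdot_tprod_coef e X : tdot (tprod_coef e) X = entry (tprod A X) e.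
Proof.
case: e => [[k i] j]; rewrite /entry tprodE /= summxE.
under [RHS]eq_bigr do rewrite mxE.
rewrite exchange_big /=; apply: eq_bigr => t _.
rewrite (bigD1 j) //= [X in _ + X]big1 => [|j' /negPf j'j].
  by rewrite addr0; apply: eq_bigr => s _; rewrite ffunE mxE eqxx.
by apply: big1 => s _; rewrite ffunE mxE j'j mul0r.
Qed.

Definition constraints (I : {set 'I_m}) : seq (tensor R l p n * R) :=
  [seq (tprod_coef e, entry B e) |
     e in [pred e : 'I_n * 'I_m * 'I_p | e.1.2 \in I]].

Lemma constraintsP (I : {set 'I_m}) (P : tensor R l p n * R -> Prop) :
  (forall c, c \in constraints I -> P c) <->
  (forall i, i \in I -> forall k j, P (tprod_coef (k, i, j), B k i j)).
Proof.
rewrite /constraints; split=> [H i iI k j|H c cI].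
  by apply: H; apply/fintype.imageP; exists (k, i, j).
by have /fintype.imageP[[[k i] j] iI ->] := cI; apply: H.
Qed.

Lemma feasible_polyhedron Ile Ieq X :
  feasible A B Ile Ieq X <->
  polyhedron tdot (constraints Ieq) (constraints Ile) X.
Proof.
rewrite /polyhedron !constraintsP /feasible /=.
split=> [[Hle Heq]|[Heq Hle]]; split=> i iI.
- move=> k j; rewrite tdot_tprod_coef.
  by rewrite /entry /= -(row_sliceE B i k ord0) -Heq // tprod_row_slice.
- move=> k j; rewrite tdot_tprod_coef.
  by have := Hle i iI ord0 j k; rewrite tprod_row_slice row_sliceE.
- move=> i0 j k; rewrite tprod_row_slice row_sliceE.
  by have := Hle i iI k j; rewrite tdot_tprod_coef.
- apply/ffunP => k; apply/matrixP => i0 j; rewrite tprod_row_slice row_sliceE.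
  by have := Heq i iI k j; rewrite tdot_tprod_coef.
Qed.

Lemma cT_subE (Ile : {set 'I_m}) (Z W : tensor R m p n) k i j :
  cT Ile (Z - W) k i j =
  if i \in Ile then Num.max (Z k i j - W k i j) 0 else Z k i j - W k i j.
Proof. by rewrite ffunE mxE !ffunE !mxE. Qed.

(** No entry of a tensor exceeds its norm in absolute value, so the factor can
    be the number of constraints. *)
Lemma violation_le_frob_norm (Ile Ieq : {set 'I_m}) X :
  [disjoint Ile & Ieq] ->
  violation tdot (constraints Ieq) (constraints Ile) X <=
  (#|[pred e : 'I_n * 'I_m * 'I_p | e.1.2 \in Ieq]| +
   #|[pred e : 'I_n * 'I_m * 'I_p | e.1.2 \in Ile]|)%:R *
  frob_norm (cT Ile (tprod A X - B)).
Proof.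
move=> disj; rewrite /violation /constraints !big_image /=.
set F := frob_norm _.
rewrite natrD mulrDl !mulr_natl -!sumr_const.
apply: lerD; apply: ler_sum => -[[k i] j]; rewrite tdot_tprod_coef inE /= => iI;
  apply: le_trans (entry_le_frob_norm _ k i j); rewrite cT_subE.
  by rewrite (disjointFl disj iI).
by rewrite iI ler_norm.
Qed.

End TensorSystem.

Theorem theorem4p3 (R : realType) (m l p n : nat)
    (A : tensor R m l n) (B : tensor R m p n) (Ile Ieq : {set 'I_m})
    (disj : [disjoint Ile & Ieq]) (cover : Ile :|: Ieq = [set: 'I_m])
    (nonempty : (feasible A B Ile Ieq !=set0)%classic) :
  exists gamma : R, 0 < gamma /\
    forall X : tensor R l p n,
      exists2 d : R, is_dist X (feasible A B Ile Ieq) d &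
        d <= gamma * frob_norm (cT Ile (tprod A X - B)).
Proof.
have [X0 /feasible_polyhedron PX0] := nonempty.
have [g g0 H] := hoffman (ex_intro _ X0 PX0).
pose N : R := (#|[pred e : 'I_n * 'I_m * 'I_p | e.1.2 \in Ieq]| +
   #|[pred e : 'I_n * 'I_m * 'I_p | e.1.2 \in Ile]|)%:R.
(* The summand 1 only makes the constant positive. *)
exists (g * N + 1); split; first by rewrite ltr_wpDl ?mulr_ge0 ?ler0n.
move=> X; have [Y [PY Ymin Ybound]] := H X.
exists (frob_norm (X - Y)).
  split; first by exists Y => //; apply/feasible_polyhedron.
  by move=> _ [Z /feasible_polyhedron PZ <-]; apply: Ymin.
rewrite mulrDl mul1r -mulrA (le_trans Ybound) // -[leLHS]addr0.
rewrite lerD ?sqrtr_ge0 //.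
exact: ler_wpM2l (violation_le_frob_norm _ _ _ disj).
Qed.
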